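(* Let $\alpha>0$, let $B\in\mathbb{R}^{n\times n}$ be a symmetric irreducible $M$-matrix with positive diagonal entries and nonpositive off-diagonal entries, and let $f(y)=\frac{\alpha}{2}\sum_{i=1}^n y_i^4+y^TBy$. Suppose that there is a nonnegative non-increasing sequence $\{\epsilon_k\}$ such that $\sum_k\epsilon_k<+\infty$, and consider the inexact ADMM $$x^{k+1}:=\mathrm{Proj}_{\mathcal{S}}\big(y^k-\tfrac{w^k}{\rho}\big),$$ $$y^{k+1}\ \text{ an approximate solution of }\ \min_y\ \Big(f(y)+(w^k)^T(x^{k+1}-y)+\tfrac{\rho}{2}\|x^{k+1}-y\|^2\Big),$$ $$w^{k+1}:=w^k+\rho(x^{k+1}-y^{k+1}),\qquad k=0,1,2,\dots,$$ in which the solution $y^{k+1}$ of the $y$-subproblem satisfies $$\|\nabla_y\mathcal{L}_\rho(x^{k+1},y^{k+1},w^k)\|=\|\nabla f(y^{k+1})-w^k-\rho(x^{k+1}-y^{k+1})\|\le\epsilon_k .$$ Then, for some $D>1$ and any given initial point $(y^0,w^0)$, if $$\rho>\max\Big\{\frac{\|w^0\|-2D\lambda_{min}(B)}{D-1},\ \frac{2D^3\alpha+2D(\lambda_{max}(B)-\lambda_{min}(B))}{D-1},\ 2(L_f+1),\ 2\alpha+2\lambda_{max}(B)\Big\},$$ where $L_f$ is the local Lipschitz constant for $\nabla f(y)$ when $\|y\|\le D$, the sequence $\{(x^k,y^k,w^k)\}$ generated by this inexact ADMM converges to some $(x^*,y^*,w^* )$, and $y^*$ is a global optimum of $$\min_{x\in\mathbb{R}^n}\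 \frac{\alpha}{2}\sum_{i=1}^n x_i^4+x^TBx\quad\text{s.t. }\|x\|_2^2=1 .$$
   Context: $\|\cdot\|$ is the Euclidean norm; $\lambda_{min}(B)$ and $\lambda_{max}(B)$ are the smallest and largest eigenvalues of $B$. $\mathcal{S}=\{x\in\mathbb{R}^n:\|x\|=1,\ x\ge0\}$ (entrywise inequality) and $\mathrm{Proj}_{\mathcal{S}}(v)=\arg\min_{x\in\mathcal{S}}\|x-v\|$ (possibly set-valued, in which case $x^{k+1}$ is an element of it). The augmented Lagrangian with parameter $\rho>0$ is $\mathcal{L}_\rho(x,y,w)=I_{\mathcal{S}}(x)+f(y)+w^T(x-y)+\frac{\rho}{2}\|x-y\|^2$, where $I_{\mathcal{S}}$ is the indicator function of $\mathcal{S}$ ($0$ on $\mathcal{S}$, $+\infty$ elsewhere). A matrix $B$ is reducible if there is a nonempty proper subset $I\subset\{1,\dots,n\}$ with $b_{ij}=0$ for all $i\in I$, $j\notin I$; otherwise it is irreducible. $B$ is an $M$-matrix if $B=sI-A$ with $A$ entrywise nonnegative and $s\ge\rho(A)$ (here $\rho(A)$ denotes the spectral radius of $A$, not the ADMM parameter $\rho$). *)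

(* Defs.v *)
From HB Require Import structures.
From mathcomp Require Import all_boot all_order all_algebra.
From mathcomp Require Import complex ring.
From mathcomp Require Import all_classical all_reals all_analysis.

Set Implicit Arguments.
Unset Strict Implicit.
Unset Printing Implicit Defensive.

Import Order.TTheory GRing.Theory Num.Theory.
Import numFieldNormedType.Exports.

Local Open Scope classical_set_scope.
Local Open Scope ring_scope.

Section Euclidean.
Context {R : realType} {n : nat}.
Implicit Types (x y u v w : 'cV[R]_n) (A : set 'cV[R]_n).

Definition dot u v : R := (u^T *m v) 0 0.

(* The library norm of a matrix is the sup norm; it induces the same topology
   as [enorm], so convergence in ['cV[R]_n] is the library's. *)
Definition enorm u : R := Num.sqrt (dot u u).

Definition grad (g : 'cV[R]_n -> R) y : 'cV[R]_n :=
  \col_i 'D_(delta_mx i 0) g y.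

Definition argmin_on A (g : 'cV[R]_n -> R) : set 'cV[R]_n :=
  [set x | A x /\ forall z, A z -> g x <= g z].

Definition proj_on A v : set 'cV[R]_n := argmin_on A (fun x => enorm (x - v)).

(* The best Lipschitz constant of [g] on the closed ball of radius [D]; the
   infimum is attained as soon as [g] is Lipschitz there. *)
Definition lipschitz_const (g : 'cV[R]_n -> 'cV[R]_n) (D : R) : R :=
  inf [set L | 0 <= L /\ forall y z, enorm y <= D -> enorm z <= D ->
                 enorm (g y - g z) <= L * enorm (y - z)].

Definition nonneg_sphere : set 'cV[R]_n :=
  [set x | enorm x = 1 /\ forall i, 0 <= x i 0].

Definition indicator_fun A x : \bar R := (if x \in A then 0 else +oo)%E.

Definition aug_lagrangian (f : 'cV[R]_n -> R) (rho : R) x y w : \bar R :=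
  (indicator_fun nonneg_sphere x
   + (f y + dot w (x - y) + rho / 2 * enorm (x - y) ^+ 2)%:E)%E.

End Euclidean.

Section Matrices.
Context {R : realType} {n : nat}.
Implicit Types A B : 'M[R]_n.

Definition lambda_min B : R := inf [set a | eigenvalue B a].
Definition lambda_max B : R := sup [set a | eigenvalue B a].

(* Complex eigenvalues are included: [A] need not be symmetric. *)
Definition spectral_radius A : R :=
  sup [set ComplexField.Normc.normc z
      | z in [set z : R[i] | eigenvalue (map_mx (real_complex R) A) z]].

Definition reducible B : Prop :=
  exists I : {set 'I_n}, [/\ I != finset.set0, I \proper [set: 'I_n]%SET
    & forall i j, i \in I -> j \notin I -> B i j = 0].

Definition irreducible B : Prop := ~ reducible B.

Definition M_matrix B : Prop :=
  exists s A, [/\ forall i j, 0 <= A i j, spectral_radius A <= s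
                & B = s%:M - A].

End Matrices.

Definition objective (R : realType) (n : nat) (alpha : R) (B : 'M[R]_n)
    (y : 'cV[R]_n) : R :=
  alpha / 2 * (\sum_i y i 0 ^+ 4) + dot y (B *m y).

(* The initial [x 0] plays no role.  On the iterates [x k.+1] lies in
   [nonneg_sphere], so the Lagrangian is finite and [fine] loses nothing. *)
Definition inexact_admm (R : realType) (n : nat) (f : 'cV[R]_n -> R) (rho : R)
    (eps : nat -> R) (x y w : nat -> 'cV[R]_n) : Prop :=
  forall k, [/\ proj_on nonneg_sphere (y k - rho^-1 *: w k) (x k.+1),
    enorm (grad (fun v => fine (aug_lagrangian f rho (x k.+1) v (w k)))
             (y k.+1)) <= eps k
    & w k.+1 = w k + rho *: (x k.+1 - y k.+1)].


Lemma is_derive_coord (R : realType) (n : nat) (i j : 'I_n) (y : 'cV[R]_n) :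
  is_derive y (delta_mx i 0 : 'cV[R]_n) (fun v : 'cV[R]_n => v j 0)
    ((j == i)%:R : R).
Proof.
apply: DeriveDef; first exact/diff_derivable/differentiable_coord.
rewrite /derive; apply/cvg_lim => //.
apply: (@cvg_trans _ ((fun=> (j == i)%:R : R) @ (0 : R)^')); last exact: cvg_cst.
apply: near_eq_cvg; near=> h.
rewrite /= !mxE eqxx andbT addrK /GRing.scale /= mulrA mulVf ?mul1r//.
by near: h; exact: nbhs_dnbhs_neq.
Unshelve. all: by end_near. Qed.

Lemma grad_aug_lagrangian (R : realType) (n : nat) (f : 'cV[R]_n -> R)
    (rho : R) (x y w : 'cV[R]_n) :
  nonneg_sphere x -> (forall i, derivable f y (delta_mx i 0)) ->
  grad (fun v => fine (aug_lagrangian f rho x v w)) y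
  = grad f y - w - rho *: (x - y).
Proof.
move=> Sx df; apply/colP => i; rewrite !mxE.
pose c (j : 'I_n) (v : 'cV[R]_n) : R := v j 0.
have -> : (fun v => fine (aug_lagrangian f rho x v w)) =
   f + \sum_j (fun v => w j 0 * (x j 0 - c j v))
     + \sum_j (fun v => rho / 2 * (x j 0 - c j v) ^+ 2).
  apply/funext => v; rewrite /aug_lagrangian /indicator_fun mem_set// add0e /=.
  rewrite sqr_sqrtr; last first.
    by rewrite /dot mxE sumr_ge0// => j _; rewrite mxE -expr2 sqr_ge0.
  rewrite /dot !mxE !fctE !fct_sumE mulr_sumr; congr (_ + _ + _).
    by apply: eq_bigr => j _; rewrite !mxE.
  by apply: eq_bigr => j _; rewrite !mxE expr2.
have dc j := is_derive_coord i j y.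
have df' := derivableP (df i).
have d1 j : is_derive y (delta_mx i 0 : 'cV[R]_n)
    (fun v => w j 0 * (x j 0 - c j v)) (- (w j 0 * (j == i)%:R)).
  apply: (@is_derive_eq _ _ _ (w j 0 \*: (cst (x j 0) - c j))).
  by rewrite sub0r scalerN.
have d2 j : is_derive y (delta_mx i 0 : 'cV[R]_n)
    (fun v => rho / 2 * (x j 0 - c j v) ^+ 2)
    (- (rho * (x j 0 - y j 0) * (j == i)%:R)).
  apply: (@is_derive_eq _ _ _ ((rho / 2) \*: (cst (x j 0) - c j) ^+ 2)).
  rewrite sub0r /GRing.scale /= expr1 /c !fctE.
  by field.
rewrite derive_val !sumrN; congr (_ - _ - _).
  by rewrite (bigD1 i)//= eqxx mulr1 big1 ?addr0// => j /negPf ->; rewrite mulr0.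
by rewrite (bigD1 i)//= eqxx mulr1 big1 ?addr0 ?mxE// => j /negPf ->;
  rewrite mulr0.
Qed.

Lemma derivable_objective (R : realType) (n : nat) (alpha : R) (B : 'M[R]_n)
    (y : 'cV[R]_n) (i : 'I_n) : derivable (objective alpha B) y (delta_mx i 0).
Proof.
pose c (j : 'I_n) (v : 'cV[R]_n) : R := v j 0.
have -> : objective alpha B = (alpha / 2) \*: (\sum_j c j ^+ 4)
   + \sum_j (c j * \sum_k (B j k \*: c k)).
  apply/funext => v; rewrite /objective /dot mxE !fctE !fct_sumE.
  congr (_ + _); apply: eq_bigr => j _; rewrite !mxE fctE fct_sumE.
  by [].
have dc j : is_derive y (delta_mx i 0 : 'cV[R]_n) (c j) ((j == i)%:R) :=
  is_derive_coord i j y.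
exact: ex_derive.
Qed.

(* Main.v *)
Require Import Defs.
From HB Require Import structures.
From mathcomp Require Import all_boot all_order all_algebra.
From mathcomp Require Import ring lra.
From mathcomp Require Import all_classical all_reals all_analysis.

Set Implicit Arguments.
Unset Strict Implicit.
Unset Printing Implicit Defensive.

Import Order.TTheory GRing.Theory Num.Theory.
Import numFieldNormedType.Exports.

Local Open Scope classical_set_scope.
Local Open Scope ring_scope.

(** The iterates live on the nonnegative unit sphere, and there the problem has
    a hidden convexity: in the variables [z_i ^ 2] the objective is strongly
    convex on the simplex, because [B i j <= 0] off the diagonal and
    [- sqrt (a * b)] is convex.  Hence a positive unit vector [p] with
    [grad f p = tau *: p] is the unique minimizer of [f] on the sphere up to
    signs ([positive_eigenvector_gap]).  In particular there is at most one
    such vector, so for the sequence [x k] to converge to it, it is enough that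
    every cluster point of the sequence is such a vector
    ([unique_cluster_cvg]).

    Cluster points are recognized as follows.  The [x]-step maximizes the inner
    product with [rho *: y k - w k] on the nonnegative sphere, and [w k] is
    [grad f (y k)] up to the error of the inner solve.  If successive [y k]
    get close to each other, then so do successive [w k], hence also [x k] and
    [y k], and a cluster point [p] maximizes the inner product with
    [rho *: p - grad f p].  For large [rho] this inner product is positive at
    [p], so that [p] is proportional to the positive part of that vector.
    Irreducibility excludes zero entries of [p], and what remains is
    [grad f p = tau *: p] ([admm_stationary_positive]).

    That [y k.+1 - y k] tends to 0 comes from the augmented Lagrangian
    ([admm_descent]): each iteration decreases it by at least the square of
    that step, up to a multiple of [eps k], and it is bounded below since the
    iterates are bounded.

    The choice of [D] makes [y k] stay in the ball of radius [D].  The equation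
    for [y k.+1], tested against [y k.+1], contains the quartic term
    [2 * alpha * \sum_i y_i ^ 4 >= 2 * alpha / n * enorm y ^ 4]; for [D] large
    its value on the sphere of radius [D] absorbs everything of order [D] in
    the equation, in particular the errors [eps] and the discrepancy between
    the eigenvalues of [B] and a cruder bound [frobenius B] on its operator
    norm.  The same largeness turns the lower bound on [rho], which grows like
    [2 * alpha * D ^ 2], into any bound on [rho] in terms of [B] and [alpha]
    that the other steps ask for. *)

(** * Euclidean geometry and cluster points *)

Section EuclideanGeometry.
Context {R : realType} {n : nat}.
Implicit Types (u v w x y z : 'cV[R]_n) (a b c : R).

Lemma dotE u v : dot u v = \sum_i u i 0 * v i 0.
Proof. by rewrite /dot mxE; apply: eq_bigr => i _; rewrite mxE. Qed.

Lemma dotC u v : dot u v = dot v u.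
Proof. by rewrite !dotE; apply: eq_bigr => i _; rewrite mulrC. Qed.

Lemma dotDl u v w : dot (u + v) w = dot u w + dot v w.
Proof.
by rewrite !dotE -big_split; apply: eq_bigr => i _; rewrite mxE mulrDl.
Qed.

Lemma dotDr u v w : dot w (u + v) = dot w u + dot w v.
Proof. by rewrite dotC dotDl !(dotC w). Qed.

Lemma dotZl c u v : dot (c *: u) v = c * dot u v.
Proof.
by rewrite !dotE mulr_sumr; apply: eq_bigr => i _; rewrite mxE mulrA.
Qed.

Lemma dotZr c u v : dot u (c *: v) = c * dot u v.
Proof. by rewrite dotC dotZl dotC. Qed.

Lemma dotNl u v : dot (- u) v = - dot u v.
Proof. by rewrite -scaleN1r dotZl mulN1r. Qed.

Lemma dotNr u v : dot u (- v) = - dot u v.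
Proof. by rewrite dotC dotNl dotC. Qed.

Lemma dotBl u v w : dot (u - v) w = dot u w - dot v w.
Proof. by rewrite dotDl dotNl. Qed.

Lemma dotBr u v w : dot w (u - v) = dot w u - dot w v.
Proof. by rewrite dotDr dotNr. Qed.

Lemma dotvv_ge0 u : 0 <= dot u u.
Proof. by rewrite dotE sumr_ge0// => i _; rewrite -expr2 sqr_ge0. Qed.

Lemma enorm_ge0 u : 0 <= enorm u. Proof. exact: sqrtr_ge0. Qed.

Lemma enorm_sqr u : enorm u ^+ 2 = dot u u.
Proof. by rewrite sqr_sqrtr ?dotvv_ge0. Qed.

Lemma enorm_sqrE u : enorm u ^+ 2 = \sum_i u i 0 ^+ 2.
Proof. by rewrite enorm_sqr dotE; apply: eq_bigr => i _; rewrite expr2. Qed.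

Lemma enorm0 : enorm (0 : 'cV[R]_n) = 0.
Proof.
by rewrite /enorm dotE big1 ?sqrtr0// => i _; rewrite mxE mul0r.
Qed.

Lemma le_enormP u c : 0 <= c -> (enorm u <= c) = (dot u u <= c ^+ 2).
Proof. by move=> c0; rewrite -enorm_sqr ler_sqr ?nnegrE ?enorm_ge0. Qed.

Lemma coord_le_enorm u i : `|u i 0| <= enorm u.
Proof.
rewrite -ler_sqr ?nnegrE ?enorm_ge0// enorm_sqrE real_normK ?num_real//.
by rewrite (bigD1 i)//= lerDl sumr_ge0// => j _; rewrite sqr_ge0.
Qed.

Lemma enorm_eq0 u : enorm u = 0 -> u = 0.
Proof.
move=> u0; apply/colP => i; rewrite mxE; apply/eqP.
by rewrite -normr_le0 -u0 coord_le_enorm.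
Qed.

Lemma enormZ c u : enorm (c *: u) = `|c| * enorm u.
Proof.
by rewrite /enorm dotZl dotZr mulrA -expr2 sqrtrM ?sqr_ge0// sqrtr_sqr.
Qed.

Lemma enormN u : enorm (- u) = enorm u.
Proof. by rewrite /enorm dotNl dotNr opprK. Qed.

Lemma enormC u v : enorm (u - v) = enorm (v - u).
Proof. by rewrite -enormN opprB. Qed.

Lemma enorm_normalize u : 0 < enorm u -> enorm ((enorm u)^-1 *: u) = 1.
Proof. by move=> u0; rewrite enormZ gtr0_norm ?invr_gt0// mulVf// gt_eqF. Qed.

Lemma cauchy_schwarz u v : dot u v <= enorm u * enorm v.
Proof.
have [/eqP/enorm_eq0 ->|u0] := boolP (enorm u == 0).
  by rewrite enorm0 mul0r dotE big1// => i _; rewrite mxE mul0r.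
have [/eqP/enorm_eq0 ->|v0] := boolP (enorm v == 0).
  by rewrite enorm0 mulr0 dotE big1// => i _; rewrite mxE mulr0.
have u_gt0 : 0 < enorm u by rewrite lt_def u0 enorm_ge0.
have v_gt0 : 0 < enorm v by rewrite lt_def v0 enorm_ge0.
have := dotvv_ge0 (enorm v *: u - enorm u *: v).
rewrite dotBl !dotBr !dotZl !dotZr (dotC v u) -!enorm_sqr => h.
have uv_gt0 := mulr_gt0 u_gt0 v_gt0.
by rewrite -subr_ge0 -(pmulr_rge0 _ uv_gt0); nra.
Qed.

Lemma cauchy_schwarz_norm u v : `|dot u v| <= enorm u * enorm v.
Proof.
rewrite ler_norml cauchy_schwarz lerNl -dotNl -[enorm u]enormN.
by rewrite cauchy_schwarz.
Qed.

Lemma enormD u v : enorm (u + v) <= enorm u + enorm v.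
Proof.
rewrite le_enormP ?addr_ge0 ?enorm_ge0// dotDl !dotDr (dotC v u).
have := cauchy_schwarz u v; rewrite -!enorm_sqr; nra.
Qed.

Lemma enormB u v : enorm (u - v) <= enorm u + enorm v.
Proof. by rewrite -[enorm v]enormN enormD. Qed.

Lemma enormB_trans u v w : enorm (u - w) <= enorm (u - v) + enorm (v - w).
Proof. by rewrite (le_trans _ (enormD _ _))// addrA subrK. Qed.

Lemma le_enorm_coord u v c : 0 <= c ->
  (forall i, `|u i 0| <= c * `|v i 0|) -> enorm u <= c * enorm v.
Proof.
move=> c0 uv; rewrite le_enormP ?mulr_ge0 ?enorm_ge0// exprMn enorm_sqrE.
rewrite -enorm_sqr enorm_sqrE mulr_sumr ler_sum// => i _.
rewrite -(real_normK (num_real (u i 0))) -(real_normK (num_real (v i 0))).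
by rewrite -exprMn ler_sqr ?nnegrE ?mulr_ge0.
Qed.

(** The operator norm of [B] is sharper, but any bound on it serves below; the
    Frobenius norm is one that needs only Cauchy-Schwarz. *)
Definition frobenius (B : 'M[R]_n) : R := Num.sqrt (\sum_i \sum_j B i j ^+ 2).

Lemma frobenius_ge0 (B : 'M[R]_n) : 0 <= frobenius B.
Proof. exact: sqrtr_ge0. Qed.

Lemma enorm_mulmx (B : 'M[R]_n) u : enorm (B *m u) <= frobenius B * enorm u.
Proof.
rewrite le_enormP ?mulr_ge0 ?frobenius_ge0 ?enorm_ge0// -enorm_sqr enorm_sqrE.
rewrite exprMn sqr_sqrtr; last first.
  by rewrite sumr_ge0// => i _; rewrite sumr_ge0// => j _; rewrite sqr_ge0.
rewrite mulr_suml ler_sum// => i _.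
have := cauchy_schwarz_norm (row i B)^T u.
have -> : dot (row i B)^T u = (B *m u) i 0.
  by rewrite dotE mxE; apply: eq_bigr => j _; rewrite !mxE.
have -> : \sum_j B i j ^+ 2 = enorm (row i B)^T ^+ 2.
  by rewrite enorm_sqrE; apply: eq_bigr => j _; rewrite !mxE.
move=> h; rewrite -exprMn -(real_normK (num_real ((B *m u) i 0))).
by rewrite ler_sqr ?nnegrE ?mulr_ge0 ?enorm_ge0.
Qed.

Lemma dot_mulmx_bound (B : 'M[R]_n) u v :
  `|dot u (B *m v)| <= frobenius B * (enorm u * enorm v).
Proof.
rewrite (le_trans (cauchy_schwarz_norm _ _))// mulrCA ler_wpM2l ?enorm_ge0//.
exact: enorm_mulmx.
Qed.

Lemma dot_sym_mulmx (B : 'M[R]_n) u v : B^T = B ->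
  dot u (B *m v) = dot v (B *m u).
Proof.
by move=> Bs; rewrite dotC /dot trmx_mul Bs mulmxA.
Qed.

Lemma enorm_le_coord u c : 0 <= c -> (forall i, `|u i 0| <= c) ->
  enorm u <= Num.sqrt n%:R * c.
Proof.
move=> c0 uc; rewrite le_enormP ?mulr_ge0 ?sqrtr_ge0// -enorm_sqr enorm_sqrE.
rewrite exprMn sqr_sqrtr ?ler0n// mulr_natl -[X in _ *+ X](card_ord n).
rewrite -sumr_const ler_sum// => i _.
by rewrite -(real_normK (num_real (u i 0))) ler_sqr ?nnegrE.
Qed.

(** The Euclidean norm dominates the sup norm, which carries the topology. *)
Lemma enorm_cvg (u : nat -> 'cV[R]_n) (l : 'cV[R]_n) :
  enorm (u k - l) @[k --> \oo] --> (0 : R) -> u @ \oo --> l.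
Proof.
move=> ul; apply/cvgrPdist_le => e e0.
move/cvgrPdist_le : ul => /(_ _ e0); apply: filterS => k.
rewrite sub0r normrN ger0_norm ?enorm_ge0// enormC => uk.
rewrite /Num.norm/= mx_normrE bigmax_le ?ltW// => -[i j] _ /=.
by rewrite (ord1 j) (le_trans (coord_le_enorm _ _)).
Qed.

(** The statement by indices keeps the estimates below free of filters. *)
Definition cluster_point (u : nat -> 'cV[R]_n) p : Prop :=
  forall e, 0 < e -> forall N, exists2 k, (N <= k)%N & enorm (u k - p) < e.

Lemma bounded_cluster (u : nat -> 'cV[R]_n) M :
  (forall k, enorm (u k) <= M) ->
  exists p, cluster_point u p.
Proof.
move=> uM.
(* A product of segments is compact as a set of row vectors: transpose. *)
have cK := @rV_compact _ n (fun=> `[- M, M]%classic)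
  (fun=> @segment_compact R _ _).
have uK : ((fun k => (u k)^T) @ \oo)
    [set v : 'rV[R]_n | forall i, `[- M, M]%classic (v ord0 i)].
  exists 0%N => // k _ i; rewrite /= mxE in_itv/= -ler_norml.
  by rewrite (le_trans (coord_le_enorm _ _)).
have [p [_ pcl]] := cK _ _ uK.
exists p^T => e e0 N.
pose d := e / (Num.sqrt n%:R + 1).
have s0 : 0 < Num.sqrt n%:R + 1 :> R by rewrite ltr_wpDl ?sqrtr_ge0.
have d0 : 0 < d by rewrite divr_gt0.
have tl : ((fun k => (u k)^T) @ \oo)
    [set v | exists2 k, (N <= k)%N & v = (u k)^T].
  by exists N => // k /= Nk; exists k.
have [v [[k Nk ->]]] := pcl _ _ tl (nbhsx_ballx p d d0).
move=> [_ pd]; exists k => //.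
have -> : e = (Num.sqrt n%:R + 1) * d by rewrite mulrC divfK ?gt_eqF.
rewrite (@le_lt_trans _ _ (Num.sqrt n%:R * d))//; last first.
  by rewrite mulrDl mul1r ltrDl.
apply: enorm_le_coord => [|i]; first exact: ltW.
have := pd ord0 i; rewrite /ball/= !mxE distrC => /ltW.
by rewrite !ord1.
Qed.

(** A subsequence staying away from [p] would have a cluster point too, and that
    point would satisfy [Q] without being [p]. *)
Lemma unique_cluster_cvg (u : nat -> 'cV[R]_n) M (Q : set 'cV[R]_n) :
  (forall k, enorm (u k) <= M) ->
  (forall p, cluster_point u p -> Q p) ->
  (forall p q, Q p -> Q q -> p = q) ->
  exists2 p, Q p & enorm (u k - p) @[k --> \oo] --> (0 : R).
Proof.
move=> uM clQ Qu; have [p pcl] := bounded_cluster uM.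
exists p; first exact: clQ.
apply/cvgr0Pnorm_lt => e e0; apply: contrapT => far.
have /choice[s sP] : forall N, exists k, (N <= k)%N /\ e <= enorm (u k - p).
  move=> N; apply: contrapT => near; apply: far; exists N => // k /= Nk.
  rewrite ger0_norm ?enorm_ge0// ltNge; apply/negP => ek.
  by apply: near; exists k.
have [q qcl] := bounded_cluster (fun N => uM (s N)).
have qp : q = p.
  apply: Qu; apply: clQ => // d d0 N.
  have [k Nk kd] := qcl _ d0 N.
  by exists (s k) => //; rewrite (leq_trans Nk)//; have [] := sP k.
have [k _] := qcl _ e0 0%N; rewrite qp ltNge => /negP; apply.
by have [] := sP k.
Qed.

End EuclideanGeometry.

Lemma bounded_sum_cvg0 (R : realType) (d : nat -> R) M :
  (forall k, 0 <= d k) -> (forall N, \sum_(0 <= k < N) d k <= M) ->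
  d @ \oo --> (0 : R).
Proof.
move=> d0 dM; apply: cvg_series_cvg_0; apply: nondecreasing_is_cvgn.
  apply/nondecreasing_seqP => N.
  by rewrite /series/= big_nat_recr//= lerDl.
by exists M => _ [N _ <-]; exact: dM.
Qed.

(** * The objective and its gradient *)

Section Objective.
Context {R : realType} {n : nat}.
Variables (alpha : R) (B : 'M[R]_n).
Hypotheses (alpha_gt0 : 0 < alpha) (B_sym : B^T = B).
Implicit Types (y z u p v : 'cV[R]_n).

Local Notation f := (objective alpha B).
Local Notation C := (frobenius B).

Definition cube y : 'cV[R]_n := \col_i y i 0 ^+ 3.

Lemma grad_objective y : grad f y = (2 * alpha) *: cube y + 2 *: (B *m y).
Proof.
apply/colP => i; rewrite !mxE.
pose c (j : 'I_n) (v : 'cV[R]_n) : R := v j 0.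
have -> : f = (alpha / 2) \*: (\sum_j c j ^+ 4)
   + \sum_j (c j * \sum_k (B j k \*: c k)).
  apply/funext => v; rewrite /objective /dot mxE !fctE !fct_sumE.
  congr (_ + _); apply: eq_bigr => j _; rewrite !mxE fctE fct_sumE.
  by [].
have dc j : is_derive y (delta_mx i 0 : 'cV[R]_n) (c j) ((j == i)%:R) :=
  is_derive_coord i j y.
rewrite derive_val.
rewrite /GRing.scale /=; congr (_ + _).
  rewrite (bigD1 i)//= eqxx mulr1 big1 ?addr0.
    by rewrite /c; field.
  by move=> j /negPf ->; rewrite mulr0.
rewrite big_split/= mulr_natl mulr2n; congr (_ + _).
  apply: eq_bigr => j _; rewrite (bigD1 i)//= eqxx mulr1 big1 ?addr0.
    by rewrite /c mulrC -{1}B_sym mxE.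
  by move=> k /negPf ->; rewrite mulr0.
rewrite (bigD1 i)//= eqxx mulr1 [X in _ + X]big1 ?addr0.
  by rewrite fct_sumE; apply: eq_bigr.
by move=> j /negPf ->; rewrite mulr0.
Qed.

Lemma dot_cube y z : dot (cube y) z = \sum_i y i 0 ^+ 3 * z i 0.
Proof. by rewrite dotE; apply: eq_bigr => i _; rewrite mxE. Qed.

(** The quartic part is convex and the quadratic part deviates from its
    tangent by exactly [dot (y - z) (B *m (y - z))]. *)
Lemma objective_tangent y z :
  f z + dot (grad f z) (y - z) - C * enorm (y - z) ^+ 2 <= f y.
Proof.
rewrite grad_objective dotDl !dotZl /objective.
have quad : dot y (B *m y) = dot z (B *m z) + 2 * dot (B *m z) (y - z)
    + dot (y - z) (B *m (y - z)).
  rewrite !(dotBr, dotBl, mulmxBr).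
  by rewrite !(dotC (B *m z)) (dot_sym_mulmx y z B_sym); ring.
have quart : \sum_i z i 0 ^+ 4 + 4 * dot (cube z) (y - z) <= \sum_i y i 0 ^+ 4.
  rewrite dot_cube mulr_sumr -big_split/= ler_sum// => i _.
  rewrite !mxE; move: (y i 0) (z i 0) => a b.
  rewrite -subr_ge0 (_ : _ - _ = (a - b) ^+ 2 * ((a + b) ^+ 2 + 2 * b ^+ 2)).
    by rewrite mulr_ge0 ?sqr_ge0// addr_ge0 ?sqr_ge0// mulr_ge0// sqr_ge0.
  by ring.
have := dot_mulmx_bound B (y - z) (y - z); rewrite ler_norml -expr2.
move=> /andP[+ _]; rewrite quad.
have a2 : 0 <= alpha / 2 by rewrite divr_ge0// ltW.
have := ler_wpM2l a2 quart; rewrite mulrDr; lra.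
Qed.

Lemma objective_ge y : - (C * enorm y ^+ 2) <= f y.
Proof.
have := dot_mulmx_bound B y y; rewrite ler_norml -expr2 => /andP[+ _].
have : 0 <= alpha / 2 * \sum_i y i 0 ^+ 4.
  apply: mulr_ge0; first by rewrite divr_ge0// ltW.
  apply: sumr_ge0 => i _; by rewrite (exprM _ 2 2) sqr_ge0.
rewrite /objective; lra.
Qed.

Lemma enorm_cube y : enorm (cube y) <= enorm y ^+ 3.
Proof.
rewrite exprS mulrC le_enorm_coord ?sqr_ge0// => i.
rewrite mxE normrX exprS mulrC ler_wpM2r//.
by rewrite ler_sqr ?nnegrE ?enorm_ge0// coord_le_enorm.
Qed.

Lemma enorm_grad_objective y :
  enorm (grad f y) <= 2 * alpha * enorm y ^+ 3 + 2 * C * enorm y.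
Proof.
rewrite grad_objective (le_trans (enormD _ _))// !enormZ !gtr0_norm ?mulr_gt0//.
by rewrite lerD// -?mulrA ?ler_pM2l// ?enorm_cube// enorm_mulmx.
Qed.

Lemma grad_objective_lipschitz D y z : enorm y <= D -> enorm z <= D ->
  enorm (grad f y - grad f z)
    <= (2 * alpha * (3 * D ^+ 2) + 2 * C) * enorm (y - z).
Proof.
move=> yD zD; rewrite !grad_objective.
have D0 : 0 <= D := le_trans (enorm_ge0 y) yD.
have -> : (2 * alpha) *: cube y + 2 *: (B *m y)
    - ((2 * alpha) *: cube z + 2 *: (B *m z))
  = (2 * alpha) *: (cube y - cube z) + 2 *: (B *m (y - z)).
  by rewrite mulmxBr !scalerBr opprD addrACA.
rewrite (le_trans (enormD _ _))// !enormZ !gtr0_norm ?mulr_gt0//.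
rewrite [leRHS]mulrDl lerD//; last first.
  by rewrite -[leRHS]mulrA ler_pM2l// enorm_mulmx.
rewrite -[leRHS]mulrA ler_pM2l ?mulr_gt0//.
rewrite le_enorm_coord ?mulr_ge0 ?sqr_ge0// => i.
rewrite !mxE subrXX !big_ord_recl big_ord0 /= !normrM mulrC ler_wpM2r//.
have yi := le_trans (coord_le_enorm y i) yD.
have zi := le_trans (coord_le_enorm z i) zD.
move: yi zi; rewrite !ler_norml => /andP[? ?] /andP[? ?].
by apply/andP; split; rewrite /bump /=; nra.
Qed.

(** The best Lipschitz constant is itself a Lipschitz constant, because the
    set of admissible constants is nonempty. *)
Lemma lipschitz_const_objective D y z : enorm y <= D -> enorm z <= D ->
  enorm (grad f y - grad f z) <= lipschitz_const (grad f) D * enorm (y - z).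
Proof.
move=> yD zD; have [yz|yz] := eqVneq (enorm (y - z)) 0.
  by rewrite yz mulr0 (subr0_eq (enorm_eq0 yz)) subrr enorm0.
have yz0 : 0 < enorm (y - z) by rewrite lt_def yz enorm_ge0.
have D0 : 0 <= D := le_trans (enorm_ge0 y) yD.
rewrite -ler_pdivrMr//; apply: lb_le_inf; last first.
  by move=> L [_ /(_ _ _ yD zD)]; rewrite ler_pdivrMr.
exists (2 * alpha * (3 * D ^+ 2) + 2 * C); split.
  by rewrite addr_ge0 ?mulr_ge0 ?frobenius_ge0 ?sqr_ge0// ltW.
by move=> *; exact: grad_objective_lipschitz.
Qed.

Lemma lipschitz_const_ge0 D : 0 <= lipschitz_const (grad f) D.
Proof.
have [S0|S0] := pselect ([set L | 0 <= L /\ forall y z, enorm y <= D ->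
    enorm z <= D -> enorm (grad f y - grad f z) <= L * enorm (y - z)] !=set0).
  by apply: lb_le_inf => // L [].
by rewrite /lipschitz_const inf_out// => -[].
Qed.

(** Chebyshev's sum inequality turns the quartic term into a fourth power of
    the norm; it beats every quadratic for large [y]. *)
Lemma grad_objective_coercive y : (0 < n)%N ->
  2 * alpha / n%:R * enorm y ^+ 4 - 2 * C * enorm y ^+ 2 <= dot y (grad f y).
Proof.
move=> n0; have nR : 0 < n%:R :> R by rewrite ltr0n.
rewrite grad_objective dotDr !dotZr.
have := dot_mulmx_bound B y y; rewrite ler_norml -expr2 => /andP[+ _].
suff : enorm y ^+ 4 / n%:R <= dot y (cube y).
  move=> h.
  have : 2 * alpha * (enorm y ^+ 4 / n%:R) <= 2 * alpha * dot y (cube y).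
    by rewrite ler_pM2l ?mulr_gt0.
  rewrite (_ : 2 * alpha * (enorm y ^+ 4 / n%:R)
    = 2 * alpha / n%:R * enorm y ^+ 4); last by ring.
  lra.
(* y_i^4 >= 2 t y_i^2 - t^2 with t the mean of the y_i^2 *)
pose t := enorm y ^+ 2 / n%:R.
have : \sum_i (2 * t * y i 0 ^+ 2 - t ^+ 2) <= dot y (cube y).
  rewrite dotC dot_cube ler_sum// => i _; have := sqr_ge0 (y i 0 ^+ 2 - t).
  by rewrite -exprSr; nra.
rewrite big_split/= -mulr_sumr -enorm_sqrE sumr_const card_ord -mulr_natl.
apply: le_trans; rewrite le_eqVlt; apply/orP; left; apply/eqP.
by rewrite /t; field; rewrite gt_eqF.
Qed.

End Objective.

(** * Stationary points of the iteration and global optimality *)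

Section StationaryPoints.
Context {R : realType} {n : nat}.
Implicit Types (u v z p q : 'cV[R]_n).

(** Testing maximality against the normalized positive part [u] of [v] gives
    [enorm u <= dot p u], the equality case of Cauchy-Schwarz. *)
Lemma nonneg_sphere_maximizer p v :
  nonneg_sphere p -> (forall z, nonneg_sphere z -> dot z v <= dot p v) ->
  0 < dot p v ->
  exists2 m, 0 < m & forall i, Num.max (v i 0) 0 = m * p i 0.
Proof.
move=> [p1 p_ge0] p_max pv.
pose u : 'cV[R]_n := \col_i Num.max (v i 0) 0.
have uE i : u i 0 = Num.max (v i 0) 0 by rewrite mxE.
have u_ge0 i : 0 <= u i 0 by rewrite uE le_max lexx orbT.
have pvu : dot p v <= dot p u.
  rewrite !dotE ler_sum// => i _; rewrite ler_wpM2l//.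
  by rewrite uE le_max lexx.
have uv : dot u v = enorm u ^+ 2.
  rewrite enorm_sqr !dotE; apply: eq_bigr => i _; rewrite uE.
  by case: (leP (v i 0) 0) => //; rewrite !mul0r.
have u0 : 0 < enorm u.
  rewrite (lt_le_trans pv)// (le_trans pvu)//.
  by rewrite (le_trans (cauchy_schwarz _ _))// p1 mul1r.
have := p_max ((enorm u)^-1 *: u).
rewrite dotZl uv expr2 mulKf ?gt_eqF// => upv.
have {}upv : enorm u <= dot p u.
  rewrite (le_trans _ pvu)// upv//; split; first exact: enorm_normalize.
  by move=> i; rewrite mxE mulr_ge0// invr_ge0 ltW.
have : enorm (u - enorm u *: p) = 0.
  apply/eqP; rewrite -sqrf_eq0 eq_le sqr_ge0 andbT enorm_sqr.
  rewrite dotBl !dotBr !dotZl !dotZr -!enorm_sqr p1 (dotC u p).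
  by nra.
move/enorm_eq0 => /subr0_eq ump; exists (enorm u) => // i.
by rewrite -uE [in LHS]ump mxE.
Qed.

Variables (alpha : R) (B : 'M[R]_n).
Hypotheses (alpha_gt0 : 0 < alpha) (B_sym : B^T = B).
Hypothesis B_offdiag : forall i j : 'I_n, i != j -> B i j <= 0.

Local Notation f := (objective alpha B).
Local Notation C := (frobenius B).

(** At a fixed point of the exact iteration [x], [y] agree and [w] is
    [grad f p], so the [x]-step says exactly this. *)
Definition admm_stationary (rho : R) : set 'cV[R]_n :=
  [set p | nonneg_sphere p /\ forall z, nonneg_sphere z ->
     dot z (rho *: p - grad f p) <= dot p (rho *: p - grad f p)].

Definition positive_eigenvector p : Prop :=
  [/\ enorm p = 1, forall i, 0 < p i 0
    & exists tau, grad f p = tau *: p].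

(** On the zero set [I] of such a [p] the gradient is both nonpositive
    (off-diagonal signs) and nonnegative (maximality), so [B] has no entry
    linking [I] to its complement. *)
Lemma admm_stationary_positive rho p : irreducible B ->
  2 * alpha + 2 * C < rho -> admm_stationary rho p -> positive_eigenvector p.
Proof.
move=> B_irr rho_big [Sp p_max]; have [p1 p_ge0] := Sp.
have pv : 0 < dot p (rho *: p - grad f p).
  rewrite dotBr dotZr -enorm_sqr p1 expr1n mulr1 subr_gt0.
  rewrite (le_lt_trans (cauchy_schwarz _ _))// p1 mul1r.
  rewrite (le_lt_trans _ rho_big)// (le_trans (enorm_grad_objective _ _ _))//.
  by rewrite p1 expr1n !mulr1.
have [m m0 vm] := nonneg_sphere_maximizer Sp p_max pv.
have vE i : (rho *: p - grad f p) i 0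
    = rho * p i 0 - (2 * alpha * p i 0 ^+ 3 + 2 * (B *m p) i 0).
  by rewrite (grad_objective _ B_sym) !mxE.
have p_gt0 i : 0 < p i 0.
  rewrite lt_def p_ge0 andbT; apply/negP => pi0; apply: B_irr.
  exists [set j | p j 0 == 0]%SET; split.
  - by apply/finset.set0Pn; exists i; rewrite finset.inE.
  - rewrite finset.properT; apply/negP => /eqP allz.
    have pz : p = 0.
      apply/colP => j; rewrite mxE; apply/eqP.
      by have := finset.in_setT j; rewrite -allz finset.inE.
    by move/eqP: p1; rewrite pz enorm0 eq_sym oner_eq0.
  - move=> j k; rewrite !finset.inE => /eqP pj0 pk0.
    have : (rho *: p - grad f p) j 0 <= 0.
      by rewrite -(mulr0 m) -pj0 -vm le_max lexx.
    rewrite vE pj0 expr0n /= !mulr0 !add0r oppr_le0 pmulr_rge0// => Bp_ge0.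
    have pk_gt0 : 0 < p k 0 by rewrite lt_def pk0 p_ge0.
    have jk : j != k by apply: contraNneq pk0 => <-; rewrite pj0.
    apply/eqP; rewrite eq_le B_offdiag//= -(pmulr_lge0 _ pk_gt0).
    rewrite (le_trans Bp_ge0)// mxE (bigD1 k)//= gerDl sumr_le0// => l _.
    have [<-|jl] := eqVneq j l; first by rewrite pj0 mulr0.
    by rewrite mulr_le0_ge0// B_offdiag.
split=> //; exists (rho - m); apply/colP => i; rewrite [RHS]mxE.
have := vm i; rewrite (max_idPl _); last first.
  by rewrite leNgt; apply/negP => vi; have := vm i;
     rewrite (max_idPr (ltW vi)) => /esym/eqP; rewrite gt_eqF// mulr_gt0.
by rewrite !mxE mulrBl => <-; rewrite opprB addrCA subrr addr0.
Qed.

(** In the variables [z_i ^ 2] the objective is strongly convex on the simplex,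
    because [- sqrt (a * b)] is convex and the off-diagonal entries of [B] are
    nonpositive.  Written with [s_i = z_i / p_i], the defect of the quadratic
    part is [- 1/2 * \sum_i \sum_j B i j * p_i * p_j * (s_i - s_j) ^ 2]. *)
Lemma positive_eigenvector_gap p z : positive_eigenvector p -> enorm z = 1 ->
  f p + alpha / 2 * \sum_i (z i 0 ^+ 2 - p i 0 ^+ 2) ^+ 2 <= f z.
Proof.
move=> [p1 p_gt0 [tau ptau]] z1.
pose s i := z i 0 / p i 0.
have zE i : z i 0 = s i * p i 0 by rewrite divfK// gt_eqF.
have BpE i : (B *m p) i 0 = (tau / 2 - alpha * p i 0 ^+ 2) * p i 0.
  have /colP/(_ i) := ptau; rewrite (grad_objective _ B_sym) !mxE.
  by move=> h; lra.
have dotBE (u : 'cV[R]_n) :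
    dot u (B *m u) = \sum_i \sum_j B i j * u i 0 * u j 0.
  rewrite dotE; apply: eq_bigr => i _; rewrite mxE mulr_sumr.
  by apply: eq_bigr => j _; rewrite mulrA (mulrC (u i 0)).
have sumE : \sum_i \sum_j B i j * p i 0 * p j 0 * s i ^+ 2
    = \sum_i (tau / 2 - alpha * p i 0 ^+ 2) * z i 0 ^+ 2.
  apply: eq_bigr => i _; rewrite zE.
  transitivity (p i 0 * s i ^+ 2 * (B *m p) i 0); last by rewrite BpE; ring.
  by rewrite mxE mulr_sumr; apply: eq_bigr => j _; ring.
have quad : \sum_i (tau / 2 - alpha * p i 0 ^+ 2) * z i 0 ^+ 2
    <= dot z (B *m z).
  have : \sum_i \sum_j B i j * p i 0 * p j 0 * (s i - s j) ^+ 2 <= 0.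
    apply: sumr_le0 => i _; apply: sumr_le0 => j _.
    have [->|ij] := eqVneq i j; first by rewrite subrr expr0n mulr0.
    rewrite mulr_le0_ge0 ?sqr_ge0// -mulrA mulr_le0_ge0 ?B_offdiag//.
    by rewrite mulr_ge0// ltW.
  have -> : \sum_i \sum_j B i j * p i 0 * p j 0 * (s i - s j) ^+ 2
    = \sum_i \sum_j B i j * p i 0 * p j 0 * s i ^+ 2
      + \sum_i \sum_j B i j * p i 0 * p j 0 * s j ^+ 2
      - 2 * dot z (B *m z).
    rewrite dotBE mulr_sumr -big_split -sumrB; apply: eq_bigr => i _ /=.
    rewrite mulr_sumr -big_split -sumrB; apply: eq_bigr => j _ /=.
    by rewrite !zE; ring.
  have -> : \sum_i \sum_j B i j * p i 0 * p j 0 * s j ^+ 2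
      = \sum_i \sum_j B i j * p i 0 * p j 0 * s i ^+ 2.
    rewrite exchange_big; apply: eq_bigr => i _; apply: eq_bigr => j _.
    by rewrite -{1}B_sym mxE; ring.
  by rewrite sumE; lra.
have pp : \sum_i p i 0 ^+ 2 = 1 by rewrite -enorm_sqrE p1 expr1n.
have zz : \sum_i z i 0 ^+ 2 = 1 by rewrite -enorm_sqrE z1 expr1n.
have pBp : dot p (B *m p) = \sum_i (tau / 2 - alpha * p i 0 ^+ 2) * p i 0 ^+ 2.
  by rewrite dotE; apply: eq_bigr => i _; rewrite BpE; ring.
have balance : alpha / 2 * (\sum_i p i 0 ^+ 4)
    + \sum_i (tau / 2 - alpha * p i 0 ^+ 2) * p i 0 ^+ 2
    + alpha / 2 * \sum_i (z i 0 ^+ 2 - p i 0 ^+ 2) ^+ 2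
  = alpha / 2 * (\sum_i z i 0 ^+ 4)
    + \sum_i (tau / 2 - alpha * p i 0 ^+ 2) * z i 0 ^+ 2.
  apply/eqP; rewrite -subr_eq0 !mulr_sumr -!big_split -sumrB /=.
  rewrite (eq_bigr (fun i => tau / 2 * (p i 0 ^+ 2 - z i 0 ^+ 2))).
    by rewrite -mulr_sumr sumrB zz pp subrr mulr0.
  by move=> i _; field.
by rewrite /objective pBp balance lerD2l.
Qed.

Lemma positive_eigenvector_unique p q :
  positive_eigenvector p -> positive_eigenvector q -> p = q.
Proof.
move=> pE qE; have [p1 p_gt0 _] := pE; have [q1 q_gt0 _] := qE.
have := positive_eigenvector_gap pE q1; have := positive_eigenvector_gap qE p1.
set S := \sum_i _; set T := \sum_i _ => hS hT.
have S0 : 0 <= S by rewrite sumr_ge0// => i _; rewrite sqr_ge0.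
have T0 : 0 <= T by rewrite sumr_ge0// => i _; rewrite sqr_ge0.
have {hS hT} : S = 0.
  have : 0 <= alpha / 2 * T by rewrite mulr_ge0// divr_ge0// ltW.
  have a2 : 0 < alpha / 2 by rewrite divr_gt0.
  move=> aT; apply/eqP; rewrite eq_le S0 andbT -(pmulr_rle0 _ a2); lra.
move=> SE; apply/colP => i; apply/eqP.
have /(_ i)/eqP := psumr_eq0P (fun i _ => sqr_ge0 _) SE (erefl : xpredT i).
by rewrite sqrf_eq0 subr_eq0 eqrXn2// ltW.
Qed.

Lemma positive_eigenvector_argmin p : positive_eigenvector p ->
  argmin_on [set z | enorm z ^+ 2 = 1] f p.
Proof.
move=> pE; have [p1 _ _] := pE; split => /=; first by rewrite p1 expr1n.
move=> z /= z1; have {}z1 : enorm z = 1.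
  by apply/eqP; rewrite -(@eqrXn2 _ 2) ?enorm_ge0// z1 expr1n.
rewrite (le_trans _ (positive_eigenvector_gap pE z1))// lerDl.
apply: mulr_ge0; first by rewrite divr_ge0// ltW.
by rewrite sumr_ge0// => i _; rewrite sqr_ge0.
Qed.

End StationaryPoints.

(** * Convergence of the inexact iteration *)

Section Iteration.
Context {R : realType} {n : nat}.
Variables (alpha : R) (B : 'M[R]_n).
Hypotheses (n_gt0 : (0 < n)%N) (alpha_gt0 : 0 < alpha) (B_sym : B^T = B).
Implicit Types (u v z p q : 'cV[R]_n).

Local Notation f := (objective alpha B).
Local Notation C := (frobenius B).

(** On the iterates the indicator term of the augmented Lagrangian vanishes. *)
Definition smooth_lagrangian rho (x y w : 'cV[R]_n) : R :=
  f y + dot w (x - y) + rho / 2 * enorm (x - y) ^+ 2.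

(** Tested against [y], the approximate optimality condition of the
    [y]-problem bounds an increasing function of [enorm y]; comparison at [D]
    gives the bound. *)
Lemma coercive_bound rho D e (y b : 'cV[R]_n) : 0 <= D -> 2 * C <= rho ->
  enorm (grad f y + rho *: y - b) <= e ->
  enorm b + e < 2 * alpha / n%:R * D ^+ 3 + (rho - 2 * C) * D ->
  enorm y <= D.
Proof.
move=> D0 rhoC ye be; rewrite leNgt; apply/negP => Dy.
have y0 : 0 < enorm y by exact: le_lt_trans Dy.
have k0 : 0 < 2 * alpha / n%:R by rewrite divr_gt0 ?mulr_gt0 ?ltr0n.
have h1 := grad_objective_coercive alpha_gt0 B_sym y n_gt0.
have h2 : dot y (grad f y + rho *: y) <= enorm y * (enorm b + e).
  rewrite (le_trans (cauchy_schwarz _ _))// ler_wpM2l ?enorm_ge0//.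
  rewrite -[X in enorm X](subrK b) (le_trans (enormD _ _))// addrC lerD2l.
  by [].
rewrite dotDr dotZr -enorm_sqr in h2.
have h3 : enorm y * (2 * alpha / n%:R * enorm y ^+ 3 + (rho - 2 * C) * enorm y)
    <= enorm y * (enorm b + e) by apply: le_trans h2; nra.
rewrite ler_pM2l// in h3.
have h4 : 2 * alpha / n%:R * D ^+ 3 <= 2 * alpha / n%:R * enorm y ^+ 3.
  by rewrite ler_pM2l// lerXn2r ?nnegrE ?enorm_ge0// ltW.
have h5 : (rho - 2 * C) * D <= (rho - 2 * C) * enorm y.
  by rewrite ler_wpM2l ?subr_ge0// ltW.
lra.
Qed.

Variables (eps : nat -> R) (rho : R) (x y w : nat -> 'cV[R]_n).
Hypotheses (eps_ge0 : forall k, 0 <= eps k).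
Hypothesis eps_noninc : nonincreasing_seq eps.
Hypothesis rho_gt0 : 0 < rho.
Hypothesis run : inexact_admm f rho eps x y w.

Let x_sphere k : nonneg_sphere (x k.+1).
Proof. by have [[]] := run k. Qed.

Let x_norm k : enorm (x k.+1) = 1.
Proof. by have [] := x_sphere k. Qed.

Let w_step k : w k.+1 - w k = rho *: (x k.+1 - y k.+1).
Proof. by have [_ _ ->] := run k; rewrite addrC addKr. Qed.

(** On unit vectors, being closest to [v] means having the largest inner
    product with [v]. *)
Lemma admm_x_optimal k z : nonneg_sphere z ->
  dot z (rho *: y k - w k) <= dot (x k.+1) (rho *: y k - w k).
Proof.
move=> Sz; have [[_ x_min] _ _] := run k; have := x_min _ Sz.
set v := y k - _ => x_min'.
have : dot z v <= dot (x k.+1) v.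
  clearbody v; move: x_min'; rewrite le_enormP ?enorm_ge0// enorm_sqr.
  rewrite !(dotBl, dotBr) !(dotC v) -!enorm_sqr x_norm.
  by have [-> _] := Sz; lra.
rewrite /v !dotBr !dotZr => h; have := ler_wpM2l (ltW rho_gt0) h.
by rewrite !mulrBr !mulrA divff ?gt_eqF// !mul1r.
Qed.

(** The multiplier is always the gradient at the current [y], up to the
    error of the last inner solve. *)
Lemma admm_multiplier k : enorm (grad f (y k.+1) - w k.+1) <= eps k.
Proof.
have [_ + ->] := run k; rewrite grad_aug_lagrangian//; last first.
  by move=> i; exact: derivable_objective.
by rewrite opprD addrA.
Qed.

Variable D : R.
Hypotheses (D_ge1 : 1 <= D) (rhoC : 4 * C + 4 <= rho).
(* The two conditions make [coercive_bound] applicable to the initial multiplier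
   and to one of the form [grad f y] plus an error with [enorm y <= D]. *)
Hypothesis first_step :
  enorm (w 0%N) + rho + eps 0%N
    < 2 * alpha / n%:R * D ^+ 3 + (rho - 2 * C) * D.
Hypothesis next_step :
  2 * alpha * D ^+ 3 + 2 * C * D + eps 0%N + rho + eps 0%N
    < 2 * alpha / n%:R * D ^+ 3 + (rho - 2 * C) * D.

Local Notation L := (lipschitz_const (grad f) D).
Hypothesis rhoL : 2 * (L + 1) < rho.

Let C_ge0 : 0 <= C := frobenius_ge0 B.
Let L_ge0 : 0 <= L := lipschitz_const_ge0 alpha B D.
Let D_ge0 : 0 <= D := le_trans ler01 D_ge1.

Let eps_le0 k : eps k <= eps 0%N.
Proof. exact: eps_noninc. Qed.

Let W := 2 * alpha * D ^+ 3 + 2 * C * D + eps 0%N.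

Let multiplier_bound k : enorm (y k.+1) <= D -> enorm (w k.+1) <= W.
Proof.
move=> yD; rewrite -[w k.+1](subKr (grad f (y k.+1))).
rewrite (le_trans (enormB _ _))// lerD ?(le_trans (admm_multiplier k))//.
rewrite (le_trans (enorm_grad_objective alpha_gt0 B_sym _))// lerD//.
  by rewrite ler_pM2l ?mulr_gt0// lerXn2r ?nnegrE ?enorm_ge0.
by rewrite ler_wpM2l// mulr_ge0.
Qed.

(** Both the given [w 0] and the later multipliers are too small to push the
    solution of the [y]-problem out of the ball, by coercivity. *)
Lemma admm_y_bounded k : enorm (y k.+1) <= D.
Proof.
have step j : enorm (w j) + rho + eps 0%N
    < 2 * alpha / n%:R * D ^+ 3 + (rho - 2 * C) * D -> enorm (y j.+1) <= D.
  move=> wj.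
  apply: (@coercive_bound rho D (eps j) _ (w j + rho *: x j.+1)) => //.
  - have := C_ge0; move: rhoC; lra.
  - have [_ _ wE] := run j; have := admm_multiplier j.
    apply: le_trans; rewrite le_eqVlt; apply/orP; left; apply/eqP.
    by rewrite wE; congr enorm; apply/colP => i; rewrite !mxE; ring.
  - rewrite (le_lt_trans _ wj)// lerD// (le_trans (enormD _ _))//.
    by rewrite enormZ x_norm mulr1 gtr0_norm.
elim: k => [|k IH]; apply: step => //.
by rewrite (le_lt_trans _ next_step)// !lerD2r multiplier_bound.
Qed.

Lemma admm_w_bounded k : enorm (w k.+1) <= W.
Proof. exact/multiplier_bound/admm_y_bounded. Qed.

(** Since multipliers are gradients up to errors, they move no faster than
    [y]. *)
Lemma admm_w_step k :
  enorm (w k.+2 - w k.+1) <= L * enorm (y k.+2 - y k.+1) + 2 * eps k.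
Proof.
have -> : w k.+2 - w k.+1 = (grad f (y k.+2) - grad f (y k.+1))
    - (grad f (y k.+2) - w k.+2) + (grad f (y k.+1) - w k.+1).
  by apply/colP => i; rewrite !mxE; ring.
rewrite (le_trans (enormD _ _))// mulr_natl mulr2n addrA.
rewrite lerD ?admm_multiplier// (le_trans (enormB _ _))// lerD//.
  by rewrite lipschitz_const_objective ?admm_y_bounded.
by rewrite (le_trans (admm_multiplier _))// eps_noninc.
Qed.

Local Notation Lag k := (smooth_lagrangian rho (x k.+1) (y k.+1) (w k.+1)).

(** The [x]-step does not increase the Lagrangian.  The [y]-step decreases it by
    [(rho / 2 - C) * d ^ 2], with [d] the length of the step, up to the error of
    the inner solve.  The multiplier step increases it by
    [enorm (w k.+2 - w k.+1) ^ 2 / rho]; the main term [L ^ 2 / rho * d ^ 2] is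
    at most [rho / 4 * d ^ 2]; the rest is bounded through [d <= 2 * D]. *)
Lemma admm_descent k :
  Lag k.+1 + enorm (y k.+2 - y k.+1) ^+ 2
    <= Lag k + (6 * D + 2 * eps 0%N) * eps k.
Proof.
have x_dec : smooth_lagrangian rho (x k.+2) (y k.+1) (w k.+1) <= Lag k.
  have := admm_x_optimal k.+1 (x_sphere k).
  rewrite /smooth_lagrangian !enorm_sqr !dotBl !dotBr !dotZr -!enorm_sqr.
  rewrite !x_norm !(dotC (y k.+1)) !(dotC (w k.+1)); lra.
have y_dec : smooth_lagrangian rho (x k.+2) (y k.+2) (w k.+1)
    + (rho / 2 - C) * enorm (y k.+2 - y k.+1) ^+ 2
    - eps k * enorm (y k.+2 - y k.+1)
   <= smooth_lagrangian rho (x k.+2) (y k.+1) (w k.+1).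
  have := objective_tangent alpha_gt0 B_sym (y k.+1) (y k.+2).
  have : dot (grad f (y k.+2) - w k.+2) (y k.+2 - y k.+1)
      <= eps k * enorm (y k.+2 - y k.+1).
    rewrite (le_trans (cauchy_schwarz _ _))// ler_wpM2r ?enorm_ge0//.
    by rewrite (le_trans (admm_multiplier _))// eps_noninc.
  have -> : w k.+2 = w k.+1 + rho *: (x k.+2 - y k.+2).
    by rewrite -w_step addrC subrK.
  rewrite (enormC (y k.+1)) /smooth_lagrangian.
  rewrite !enorm_sqr !(dotBl, dotBr, dotDl, dotZl).
  rewrite (dotC (y k.+2) (x _)) (dotC (y k.+1) (x _)) (dotC (y k.+1) (y k.+2)).
  lra.
have w_inc : Lag k.+1 = smooth_lagrangian rho (x k.+2) (y k.+2) (w k.+1)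
    + enorm (w k.+2 - w k.+1) ^+ 2 / rho.
  rewrite /smooth_lagrangian.
  rewrite {1}(_ : w k.+2 = w k.+1 + (w k.+2 - w k.+1)); last first.
    by rewrite addrC subrK.
  rewrite dotDl !w_step dotZl !enorm_sqr dotZl dotZr.
  by field; rewrite gt_eqF.
have := admm_w_step k; have := eps_le0 k; have := eps_ge0 k.
have := enorm_ge0 (w k.+2 - w k.+1); have := enorm_ge0 (y k.+2 - y k.+1).
have : enorm (y k.+2 - y k.+1) <= 2 * D.
  by rewrite (le_trans (enormB _ _))// mulr_natl mulr2n lerD// admm_y_bounded.
move: x_dec y_dec; rewrite w_inc.
set a := enorm (w _ - _); set d := enorm (y _ - _); move=> x_dec y_dec.
move=> dD d0 a0 e0 ee ale.
have a_sqr : a ^+ 2 / rho <= rho / 4 * d ^+ 2 + (4 * D + 2 * eps 0%N) * eps k.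
  rewrite ler_pdivrMr//.
  have r2 : 0 <= rho / 2 by rewrite divr_ge0// ltW.
  have a2 : a ^+ 2 <= (L * d + 2 * eps k) ^+ 2.
    by rewrite ler_sqr ?nnegrE// addr_ge0 ?mulr_ge0.
  have Lr : L * d <= rho / 2 * d by rewrite ler_wpM2r//; move: rhoL; lra.
  have Ld0 : 0 <= L * d by rewrite mulr_ge0.
  rewrite (le_trans a2)//.
  have t1 : (L * d) ^+ 2 <= (rho / 2 * d) ^+ 2.
    by rewrite ler_sqr ?nnegrE//; exact: mulr_ge0.
  have t2 : (L * d) * eps k <= (rho / 2 * (2 * D)) * eps k.
    by rewrite ler_wpM2r// (le_trans Lr)// ler_wpM2l.
  have t3 : eps k * eps k <= eps 0%N * eps k by rewrite ler_wpM2r.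
  have t4 : 2 * (eps 0%N * eps k) <= rho * (eps 0%N * eps k).
    by rewrite ler_wpM2r ?mulr_ge0//; move: rhoL L_ge0; lra.
  nra.
have d2 : d ^+ 2 <= (rho / 4 - C) * d ^+ 2.
  by rewrite -[leLHS]mul1r ler_wpM2r ?sqr_ge0//; move: rhoC; lra.
have de : eps k * d <= 2 * D * eps k by rewrite mulrC ler_wpM2r.
lra.
Qed.

Hypothesis eps_sum : cvgn (series eps).

Let eps_cvg0 : eps k @[k --> \oo] --> (0 : R).
Proof. exact: cvg_series_cvg_0. Qed.

(** The Lagrangian is bounded below on the iterates, so the accumulated decrease
    is finite. *)
Lemma admm_y_step_cvg0 : enorm (y k.+2 - y k.+1) @[k --> \oo] --> (0 : R).
Proof.
pose K := 6 * D + 2 * eps 0%N; pose E := limn (series eps).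
have K0 : 0 <= K by rewrite addr_ge0// mulr_ge0.
have sum_eps N : \sum_(0 <= k < N) eps k <= E.
  apply: (nondecreasing_cvgn_le _ eps_sum).
  by apply/nondecreasing_seqP => m; rewrite /series/= big_nat_recr//= lerDl.
have dec N : Lag N + \sum_(0 <= k < N) enorm (y k.+2 - y k.+1) ^+ 2
    <= Lag 0%N + K * \sum_(0 <= k < N) eps k.
  elim: N => [|N IH]; first by rewrite !big_geq// mulr0.
  rewrite !big_nat_recr//= mulrDr; have := admm_descent N; rewrite -/K.
  by move: IH; lra.
have Lag_ge N : - (C * D ^+ 2) - W * (1 + D) <= Lag N.
  have f_ge := objective_ge B alpha_gt0 (y N.+1).
  have yD2 : C * enorm (y N.+1) ^+ 2 <= C * D ^+ 2.
    by rewrite ler_wpM2l// lerXn2r ?nnegrE ?enorm_ge0// admm_y_bounded.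
  have := cauchy_schwarz_norm (w N.+1) (x N.+1 - y N.+1).
  rewrite ler_norml => /andP[+ _].
  have : enorm (w N.+1) * enorm (x N.+1 - y N.+1) <= W * (1 + D).
    rewrite ler_pM ?enorm_ge0 ?admm_w_bounded//.
    by rewrite (le_trans (enormB _ _))// x_norm lerD2l admm_y_bounded.
  have : 0 <= rho / 2 * enorm (x N.+1 - y N.+1) ^+ 2.
    by rewrite mulr_ge0 ?sqr_ge0// divr_ge0// ltW.
  by rewrite /smooth_lagrangian; lra.
have sq0 : (fun k => enorm (y k.+2 - y k.+1) ^+ 2) @ \oo --> (0 : R).
  apply: (@bounded_sum_cvg0 _ _ (Lag 0%N + K * E + C * D ^+ 2 + W * (1 + D))).
    by move=> k; exact: sqr_ge0.
  move=> N; have := dec N; have := Lag_ge N.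
  have := ler_wpM2l K0 (sum_eps N); lra.
have -> : (fun k => enorm (y k.+2 - y k.+1))
    = (fun k => Num.sqrt (enorm (y k.+2 - y k.+1) ^+ 2)).
  by apply/funext => k; rewrite sqrtr_sqr ger0_norm// enorm_ge0.
rewrite [X in _ --> X](_ : 0 = Num.sqrt 0); last by rewrite sqrtr0.
by apply: continuous_cvg sq0; exact: sqrt_continuous.
Qed.

Lemma admm_w_step_cvg0 : enorm (w k.+2 - w k.+1) @[k --> \oo] --> (0 : R).
Proof.
apply: (@squeeze_cvgr _ _ _ _ (fun=> 0)
    (fun k => L * enorm (y k.+2 - y k.+1) + 2 * eps k)).
- by apply: nearW => k; rewrite enorm_ge0 admm_w_step.
- exact: cvg_cst.
rewrite [X in _ --> X](_ : 0 = L * 0 + 2 * 0); last by rewrite !mulr0 addr0.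
by apply: cvgD; apply: cvgMl_tmp => //; exact: admm_y_step_cvg0.
Qed.

Lemma admm_residual_cvg0 : enorm (x k.+2 - y k.+2) @[k --> \oo] --> (0 : R).
Proof.
have -> : (fun k => enorm (x k.+2 - y k.+2))
    = (fun k => rho^-1 * enorm (w k.+2 - w k.+1)).
  apply/funext => k; rewrite w_step enormZ gtr0_norm// mulrA mulVf ?mul1r//.
  by rewrite gt_eqF.
rewrite [X in _ --> X](_ : 0 = rho^-1 * 0); last by rewrite mulr0.
by apply: cvgMl_tmp; exact: admm_w_step_cvg0.
Qed.

(** The iterate [x k.+2] maximizes the inner product with a vector that differs
    by at most this from the one that [admm_stationary] requires. *)
Let defect k := (rho + L) * (enorm (y k.+2 - y k.+1) + enorm (x k.+2 - y k.+2))
  + eps k.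

Let defect_cvg0 : defect k @[k --> \oo] --> (0 : R).
Proof.
rewrite [X in _ --> X](_ : 0 = (rho + L) * (0 + 0) + 0); last first.
  by rewrite !addr0 mulr0.
apply: cvgD => //; apply: cvgMl_tmp; apply: cvgD.
- exact: admm_y_step_cvg0.
- exact: admm_residual_cvg0.
Qed.

Lemma admm_defect k : enorm ((rho *: x k.+2 - grad f (x k.+2))
    - (rho *: y k.+1 - w k.+1)) <= defect k.
Proof.
have xy : enorm (x k.+2 - y k.+1)
    <= enorm (y k.+2 - y k.+1) + enorm (x k.+2 - y k.+2).
  by rewrite [leRHS]addrC enormB_trans.
have -> : (rho *: x k.+2 - grad f (x k.+2)) - (rho *: y k.+1 - w k.+1)
  = rho *: (x k.+2 - y k.+1) - (grad f (x k.+2) - grad f (y k.+1))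
    - (grad f (y k.+1) - w k.+1).
  by apply/colP => i; rewrite !mxE; ring.
rewrite (le_trans (enormB _ _))// lerD ?admm_multiplier//.
rewrite (le_trans (enormB _ _))// mulrDl lerD//.
  by rewrite enormZ gtr0_norm// ler_pM2l.
rewrite (le_trans _ (ler_wpM2l _ xy))// lipschitz_const_objective//.
  by rewrite x_norm.
exact: admm_y_bounded.
Qed.

(** [admm_stationary] is a closed condition, met by the iterates up to an error
    that vanishes. *)
Lemma admm_cluster_stationary p :
  cluster_point (fun k => x k.+2) p ->
  admm_stationary alpha B rho p.
Proof.
move=> pcl.
have p1 : enorm p = 1.
  apply/eqP; rewrite -subr_eq0 -normr_le0; apply/ler_addgt0Pl => e e0.
  rewrite addr0; have [k _ /ltW xp] := pcl _ e0 0%N.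
  rewrite (le_trans _ xp)// -(x_norm k.+1) ler_norml.
  have := enormD (x k.+2 - p) p; have := enormD (p - x k.+2) (x k.+2).
  by rewrite !subrK enormC; lra.
split; first split => // i.
  rewrite -oppr_le0; apply/ler_addgt0Pl => e e0; rewrite addr0.
  have [k _ /ltW xp] := pcl _ e0 0%N; rewrite (le_trans _ xp)//.
  rewrite (le_trans _ (coord_le_enorm _ i))// (le_trans _ (ler_norm _))//.
  by have [_ /(_ i)] := x_sphere k.+1; rewrite !mxE; lra.
move=> z Sz; have [z1 _] := Sz; set g := rho *: p - grad f p.
apply/ler_addgt0Pr => e e0.
pose c := 2 * (rho + L) + enorm g + 1.
have c0 : 0 < c.
  by rewrite ltr_wpDl// addr_ge0 ?enorm_ge0// mulr_ge0// addr_ge0// ltW.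
have e4 : 0 < e / 4 by rewrite divr_gt0.
have e2c : 0 < e / 2 / c by rewrite !divr_gt0.
have [N _ smallN] := (cvgr0Pnorm_lt _).1 defect_cvg0 _ e4.
have [k Nk xp] := pcl _ e2c N.
have := smallN k Nk; rewrite /= => /(le_lt_trans (ler_norm _)) dk.
set u := x k.+2 in xp *; set v := rho *: y k.+1 - w k.+1.
have opt : dot z v <= dot u v by exact: admm_x_optimal.
have gv : enorm (g - v) <= (rho + L) * enorm (u - p) + defect k.
  apply: (le_trans (enormB_trans _ (rho *: u - grad f u) _)).
  apply: lerD; last exact: admm_defect.
  have -> : g - (rho *: u - grad f u) = (grad f u - grad f p) - rho *: (u - p).
    by apply/colP => i; rewrite !mxE; ring.
  rewrite (le_trans (enormB _ _))// addrC mulrDl enormZ gtr0_norm// lerD2l.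
  by rewrite lipschitz_const_objective ?p1 ?x_norm.
have zu : dot (z - u) (g - v) <= 2 * enorm (g - v).
  rewrite (le_trans (cauchy_schwarz _ _))// ler_wpM2r ?enorm_ge0//.
  by rewrite (le_trans (enormB _ _))// z1 x_norm.
have ug : dot (u - p) g <= enorm (u - p) * enorm g by exact: cauchy_schwarz.
have cup : c * enorm (u - p) <= e / 2.
  by rewrite -ler_pdivlMl// mulrC ltW.
have up0 := enorm_ge0 (u - p).
have split_eq : dot z g - dot p g
    = dot (z - u) (g - v) + (dot z v - dot u v) + dot (u - p) g.
  by rewrite !dotBl !dotBr; ring.
by move: cup; rewrite /c; lra.
Qed.

Hypotheses (B_offdiag : forall i j : 'I_n, i != j -> B i j <= 0)
  (B_irr : irreducible B) (rho_grad : 2 * alpha + 2 * C < rho).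

Lemma admm_cvg : exists xs ys ws : 'cV[R]_n,
  [/\ x @ \oo --> xs, y @ \oo --> ys, w @ \oo --> ws
    & argmin_on [set z | enorm z ^+ 2 = 1] f ys].
Proof.
have [p pE xp] : exists2 p, positive_eigenvector alpha B p
    & enorm (x k.+2 - p) @[k --> \oo] --> (0 : R).
  apply: (@unique_cluster_cvg _ _ (fun k => x k.+2) 1).
  - by move=> k; rewrite x_norm.
  - move=> p /admm_cluster_stationary pS.
    exact: (admm_stationary_positive _ _ _ B_irr rho_grad pS).
  - by move=> p q; exact: positive_eigenvector_unique.
have yp : enorm (y k.+2 - p) @[k --> \oo] --> (0 : R).
  apply: (@squeeze_cvgr _ _ _ _ (fun=> 0)
      (fun k => enorm (x k.+2 - y k.+2) + enorm (x k.+2 - p))).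
  - apply: nearW => k; rewrite enorm_ge0/=.
    by rewrite (enormC (x k.+2)) enormB_trans.
  - exact: cvg_cst.
  rewrite [X in _ --> X](_ : 0 = 0 + 0); last by rewrite addr0.
  by apply: cvgD => //; exact: admm_residual_cvg0.
have wp : enorm (w k.+2 - grad f p) @[k --> \oo] --> (0 : R).
  apply: (@squeeze_cvgr _ _ _ _ (fun=> 0)
      (fun k => eps k + L * enorm (y k.+2 - p))).
  - apply: nearW => k; rewrite enorm_ge0/=.
    rewrite (le_trans (enormB_trans _ (grad f (y k.+2)) _))// lerD//.
      by rewrite enormC (le_trans (admm_multiplier _))// eps_noninc.
    rewrite lipschitz_const_objective ?admm_y_bounded//.
    by have [-> _ _] := pE.
  - exact: cvg_cst.
  rewrite [X in _ --> X](_ : 0 = 0 + L * 0); last by rewrite mulr0 addr0.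
  by apply: cvgD => //; exact: cvgMl_tmp.
have shift (u : nat -> 'cV[R]_n) l :
    enorm (u k.+2 - l) @[k --> \oo] --> (0 : R) -> u @ \oo --> l.
  by move=> ul; rewrite -cvg_shiftS -cvg_shiftS; exact: enorm_cvg ul.
exists p, p, (grad f p); split; [exact: shift|exact: shift|exact: shift|].
exact: positive_eigenvector_argmin.
Qed.

End Iteration.

(** * The choice of the radius *)

(** With [kappa = 2 * alpha / n] this provides a radius at which the coercive
    term of the [y]-problem beats any prescribed multiple of the radius. *)
Lemma cubic_dominates (R : realFieldType) (kappa T : R) : 0 < kappa -> 0 <= T ->
  exists2 D, 2 <= D & T * D <= kappa * D ^+ 3.
Proof.
move=> kappa0 T0; have D2 : 2 <= 2 + T / kappa by rewrite lerDl divr_ge0// ltW.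
have TD : T <= kappa * (2 + T / kappa).
  by rewrite mulrDr (mulrC _ (T / kappa)) divfK ?gt_eqF// lerDr mulr_ge0// ltW.
move: (2 + T / kappa) D2 TD => D D2 TD; exists D => //.
rewrite exprSr mulrA ler_wpM2r//; first by lra.
by rewrite (le_trans TD)// ler_pM2l// expr2 ler_peMr//; lra.
Qed.

Theorem theorem4p6 (R : realType) (n : nat) (n_gt0 : (0 < n)%N)
    (alpha : R) (alpha_gt0 : 0 < alpha) (B : 'M[R]_n)
    (B_sym : B^T = B) (B_irr : irreducible B) (B_M : M_matrix B)
    (B_diag : forall i, 0 < B i i)
    (B_offdiag : forall i j : 'I_n, i != j -> B i j <= 0)
    (eps : nat -> R) (eps_ge0 : forall k, 0 <= eps k)
    (eps_noninc : nonincreasing_seq eps) (eps_sum : cvgn (series eps)) :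
  let f := objective alpha B in
  exists2 D : R, 1 < D &
    forall (y0 w0 : 'cV[R]_n) (rho : R),
      let L_f := lipschitz_const (grad f) D in
      0 < rho ->
      Num.max
        (Num.max ((enorm w0 - 2 * D * lambda_min B) / (D - 1))
                 ((2 * D ^+ 3 * alpha
                   + 2 * D * (lambda_max B - lambda_min B)) / (D - 1)))
        (Num.max (2 * (L_f + 1)) (2 * alpha + 2 * lambda_max B)) < rho ->
      forall x y w : nat -> 'cV[R]_n,
        y 0%N = y0 -> w 0%N = w0 -> inexact_admm f rho eps x y w ->
        exists xs ys ws : 'cV[R]_n,
          [/\ x @ \oo --> xs, y @ \oo --> ys, w @ \oo --> ws
            & argmin_on [set z | enorm z ^+ 2 = 1] f ys].

Proof.
move=> f.
have kappa0 : 0 < 2 * alpha / n%:R by rewrite divr_gt0 ?mulr_gt0 ?ltr0n.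
have kappa_le : 2 * alpha / n%:R <= 2 * alpha.
  by rewrite ler_pdivrMr ?ltr0n// ler_peMr ?ler1n// mulr_ge0// ltW.
have [M [M0 lminM dlM]] : exists M, [/\ 0 <= M, lambda_min B <= M
    & - M <= lambda_max B - lambda_min B].
  exists (`|lambda_min B| + `|lambda_max B|).
  move: (lambda_min B) (lambda_max B) => l m.
  have := ler_norm (- l); have := ler_norm (- m); have := ler_norm l.
  by rewrite !normrN; have := normr_ge0 m; have := normr_ge0 l; split; lra.
have C0 := frobenius_ge0 B; have e0 := eps_ge0 0%N.
have [|D D2 kD] := @cubic_dominates _ (2 * alpha / n%:R)
  (4 * frobenius B + 2 * M + 2 * eps 0%N + 4 + 2 * alpha) kappa0.
  by lra.
(* In the coefficient of D, [2 * frobenius B] comes from the quadratic part of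
   the coercive bound and as much again from the size of [w k], [2 * M] from the
   eigenvalues in the lower bounds on rho, [2 * eps 0] from the errors of two
   inner solves; [4 + 2 * alpha] is for [rho_big]. *)
exists D; first by lra.
have D0 : 0 <= D by lra.
have D1 : 0 < D - 1 by lra.
move=> y0 w0 rho L_f rho_gt0; rewrite !gt_max.
move=> /andP[/andP[r1 r2] /andP[r3 _]].
rewrite !ltr_pdivrMr// in r1 r2.
move=> x y w _ w_init run.
have DlminM := ler_wpM2r D0 lminM.
have DdlM := ler_wpM2r D0 dlM.
have eD : eps 0%N <= eps 0%N * D by rewrite ler_peMr//; lra.
have CD : 0 <= frobenius B * D by rewrite mulr_ge0.
have MD : 0 <= M * D by rewrite mulr_ge0.
have aD : 0 <= alpha * D by rewrite mulr_ge0// ltW.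
have aD3 : 2 * alpha / n%:R * D ^+ 3 <= 2 * alpha * D ^+ 3.
  by rewrite ler_wpM2r// exprn_ge0.
have rho_big : 4 * frobenius B + 4 + 2 * alpha < rho.
  by rewrite -(ltr_pM2r D1); apply: le_lt_trans r2; lra.
apply: (admm_cvg n_gt0 alpha_gt0 B_sym eps_ge0 eps_noninc rho_gt0 run (D := D))
  => //; rewrite ?w_init; lra.
Qed.
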